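(* Let $f:\mathbb{R}^n\times\mathbb{R}^p\times\mathbb{R}^q\to\mathbb{R}^n$ be continuously differentiable, let $N:\mathbb{R}^n\to\mathbb{R}^p$ be a feed-forward neural network controller, and let $f^{\mathrm{c}}(x,w)=f(x,N(x),w)$ be the closed-loop vector field. Let $y\le\widehat{y}$ in $\mathbb{R}^n$ and suppose that $N$ satisfies the affine bounds $$\underline{C}(y,\widehat{y})z+\underline{d}(y,\widehat{y})\le N(z)\le\overline{C}(y,\widehat{y})z+\overline{d}(y,\widehat{y})\qquad\text{for every }z\in[y,\widehat{y}],$$ with $\underline{C}(y,\widehat{y}),\overline{C}(y,\widehat{y})\in\mathbb{R}^{p\times n}$ and $\underline{d}(y,\widehat{y}),\overline{d}(y,\widehat{y})\in\mathbb{R}^p$. For every $[x,\widehat{x}]\subseteq[y,\widehat{y}]$ and every $w\le\widehat{w}$ in $\mathbb{R}^q$, let $u\le\widehat{u}$ in $\mathbb{R}^p$ be such that $N(z)\in[u,\widehat{u}]$ for every $z\in[x,\widehat{x}]$, and assume that for every $z\in[x,\widehat{x}]$, $\xi\in[u,\widehat{u}]$, $\eta\in[w,\widehat{w}]$, $$D_zf(z,\xi,\eta)\in[\underline{J}_{[x,\widehat{x}]},\overline{J}_{[x,\widehat{x}]}],\quad D_\xi f(z,\xi,\eta)\in[\underline{J}_{[u,\widehat{u}]},\overline{J}_{[u,\widehat{u}]}],\quad D_\eta f(z,\xi,\eta)\in[\underline{J}_{[w,\widehat{w}]},\overline{J}_{[w,\widehat{w}]}].$$ Then the map $\mathsf{F}^{\mathrm{act}}_{[y,\widehat{y}]}$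 defined by $$\mathsf{F}^{\mathrm{act}}_{[y,\widehat{y}]}(x,\widehat{x},w,\widehat{w})=\begin{bmatrix}[\underline{H}]^+-\underline{J}_{[x,\widehat{x}]} & [\underline{H}]^-\\ [\overline{H}]^--\overline{J}_{[x,\widehat{x}]} & [\overline{H}]^+\end{bmatrix}\begin{bmatrix}x\\ \widehat{x}\end{bmatrix}+L\begin{bmatrix}w\\ \widehat{w}\end{bmatrix}+Q$$ is a $[y,\widehat{y}]\times\mathbb{R}^q$-localized inclusion function for $f^{\mathrm{c}}$, where $$\underline{H}=\underline{J}_{[x,\widehat{x}]}+[\underline{J}_{[u,\widehat{u}]}]^+\underline{C}(y,\widehat{y})+[\underline{J}_{[u,\widehat{u}]}]^-\overline{C}(y,\widehat{y}),$$ $$\overline{H}=\overline{J}_{[x,\widehat{x}]}+[\overline{J}_{[u,\widehat{u}]}]^+\overline{C}(y,\widehat{y})+[\overline{J}_{[u,\widehat{u}]}]^-\underline{C}(y,\widehat{y}),$$ $$L=\begin{bmatrix}-[\underline{J}_{[w,\widehat{w}]}]^- & [\underline{J}_{[w,\widehat{w}]}]^-\\ -[\overline{J}_{[w,\widehat{w}]}]^+ & [\overline{J}_{[w,\widehat{w}]}]^+\end{bmatrix},$$ $$Q=\begin{bmatrix}-\underline{J}_{[u,\widehat{u}]}u+[\underline{J}_{[u,\widehat{u}]}]^+\underline{d}(y,\widehat{y})+[\underline{J}_{[u,\widehat{u}]}]^-\overline{d}(y,\widehat{y})+f(x,u,w)\\ -\overline{J}_{[u,\widehat{u}]}u+[\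overline{J}_{[u,\widehat{u}]}]^+\overline{d}(y,\widehat{y})+[\overline{J}_{[u,\widehat{u}]}]^-\underline{d}(y,\widehat{y})+f(x,u,w)\end{bmatrix}.$$
   Context: Inequalities between vectors or matrices are entrywise; $[x,\widehat{x}]=\{z: x\le z\le\widehat{x}\}$, and $M\in[\underline{J},\overline{J}]$ means $\underline{J}\le M\le\overline{J}$ entrywise. For a matrix $B$, $[B]^+=\max(B,0)$ and $[B]^-=\min(B,0)$ entrywise. $D_zf,D_\xi f,D_\eta f$ denote the partial Jacobians of $f$ with respect to its first, second and third arguments. A map $\mathsf{F}=\begin{bmatrix}\underline{\mathsf{F}}\\ \overline{\mathsf{F}}\end{bmatrix}$ is a $[y,\widehat{y}]\times\mathbb{R}^q$-localized inclusion function for $f^{\mathrm{c}}$ if $\underline{\mathsf{F}}(x,\widehat{x},w,\widehat{w})\le f^{\mathrm{c}}(z,\eta)\le\overline{\mathsf{F}}(x,\widehat{x},w,\widehat{w})$ for every $[x,\widehat{x}]\subseteq[y,\widehat{y}]$, every $w\le\widehat{w}$ in $\mathbb{R}^q$, every $z\in[x,\widehat{x}]$ and every $\eta\in[w,\widehat{w}]$. The quantities $u,\widehat{u}$ and the bounds $\underline{J},\overline{J}$ are allowed to depend on $x,\widehat{x},w,\widehat{w}$ (and on $y,\widehat{y}$). Neural network controller. $N$ is a $k$-layer feed-forward network: $\xi^{(0)}=x$, $\xi^{(i)}=\phi^{(i-1)}(W^{(i-1)}\xi^{(i-1)}+b^{(i-1)})$ for $i=1,\dots,k$, and $N(x)=W^{(k)}\xi^{(k)}+b^{(k)}$,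 with weight matrices $W^{(i)}$, bias vectors $b^{(i)}$, and diagonal (entrywise) activation functions $\phi^{(i-1)}$ whose components satisfy $0\le\frac{\phi^{(i-1)}_j(a)-\phi^{(i-1)}_j(b)}{a-b}\le1$ for all real $a\ne b$. *)

(* Defs.v *)
From mathcomp Require Import all_boot all_order all_algebra.
From mathcomp Require Import all_classical all_reals all_analysis.

Set Implicit Arguments.
Unset Strict Implicit.
Unset Printing Implicit Defensive.

Import Order.TTheory GRing.Theory Num.Theory.
Import numFieldNormedType.Exports.

Local Open Scope classical_set_scope.
Local Open Scope ring_scope.

Definition mxle (R : realType) (m n : nat) (A B : 'M[R]_(m, n)) : Prop :=
  forall i j, A i j <= B i j.

Definition box (R : realType) (m n : nat) (A B : 'M[R]_(m, n)) :
    set 'M[R]_(m, n) :=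
  [set M | mxle A M /\ mxle M B].

Definition mxpos (R : realType) (m n : nat) (B : 'M[R]_(m, n)) : 'M[R]_(m, n) :=
  map_mx (fun b => Num.max b 0) B.

Definition mxneg (R : realType) (m n : nat) (B : 'M[R]_(m, n)) : 'M[R]_(m, n) :=
  map_mx (fun b => Num.min b 0) B.

(* The library's [jacobian] is for maps between row vectors and acts on the
   right; transposing gives the usual matrix, with (i, j) entry dg_i / dx_j. *)
Definition cjacobian (R : realType) (m n : nat) (g : 'cV[R]_n -> 'cV[R]_m)
    (x : 'cV[R]_n) : 'M[R]_(m, n) :=
  (jacobian (fun v : 'rV[R]_n => (g v^T)^T) x^T)^T.

(* Continuity of the differential is required at each direction [v]; in finite
   dimension this is the same as continuity in operator norm. *)
Definition continuously_differentiable (R : realType) (V W : normedModType R)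
    (g : V -> W) : Prop :=
  (forall t, differentiable g t) /\
  (forall v, continuous (fun t => 'd g t v)).

Section VectorField.
Context {R : realType} {n p q : nat}.
Variable f : 'cV[R]_n -> 'cV[R]_p -> 'cV[R]_q -> 'cV[R]_n.

Definition uncurry3 (t : 'cV[R]_n * 'cV[R]_p * 'cV[R]_q) : 'cV[R]_n :=
  f t.1.1 t.1.2 t.2.

Definition Dz z xi eta : 'M[R]_(n, n) := cjacobian (fun z' => f z' xi eta) z.
Definition Dxi z xi eta : 'M[R]_(n, p) := cjacobian (fun xi' => f z xi' eta) xi.
Definition Deta z xi eta : 'M[R]_(n, q) := cjacobian (f z xi) eta.

Definition closed_loop (N : 'cV[R]_n -> 'cV[R]_p) (x : 'cV[R]_n)
    (w : 'cV[R]_q) : 'cV[R]_n :=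
  f x (N x) w.
End VectorField.

Definition layer_dim (n : nat) (hwidth : nat -> nat) (i : nat) : nat :=
  if i is i'.+1 then hwidth i' else n.

(* [weight i], [bias i] and [act i] are the data of the step from layer [i] to
   layer [i.+1]; only the indices [i < depth] contribute to the network. *)
Record ffnn (R : realType) (n p : nat) := FFNN {
  depth : nat;
  hwidth : nat -> nat;
  weight : forall i, 'M[R]_(layer_dim n hwidth i.+1, layer_dim n hwidth i);
  bias : forall i, 'cV[R]_(layer_dim n hwidth i.+1);
  act : forall i, 'I_(layer_dim n hwidth i.+1) -> R -> R;
  out_weight : 'M[R]_(p, layer_dim n hwidth depth);
  out_bias : 'cV[R]_p;
  act_slope : forall i, (i < depth)%N ->
    forall (j : 'I_(layer_dim n hwidth i.+1)) (a b : R), a != b ->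
      0 <= (act j a - act j b) / (a - b) <= 1
}.

Fixpoint nn_layer (R : realType) (n p : nat) (N : ffnn R n p) (x : 'cV[R]_n)
    (i : nat) : 'cV[R]_(layer_dim n (hwidth N) i) :=
  match i with
  | 0 => x
  | i'.+1 => \col_j act j ((weight N i' *m nn_layer N x i' + bias N i') j 0)
  end.

Definition nn_eval (R : realType) (n p : nat) (N : ffnn R n p) (x : 'cV[R]_n) :
    'cV[R]_p :=
  out_weight N *m nn_layer N x (depth N) + out_bias N.

Coercion nn_eval : ffnn >-> Funclass.

(* The lower and upper bounding maps are the two blocks of [F]. *)
Definition localized_inclusion (R : realType) (n q : nat) (y yh : 'cV[R]_n)
    (F : 'cV[R]_n -> 'cV[R]_n -> 'cV[R]_q -> 'cV[R]_q -> 'cV[R]_(n + n))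
    (g : 'cV[R]_n -> 'cV[R]_q -> 'cV[R]_n) : Prop :=
  forall (x xh : 'cV[R]_n) (w wh : 'cV[R]_q),
    mxle x xh -> box x xh `<=` box y yh -> mxle w wh ->
    forall (z : 'cV[R]_n) (eta : 'cV[R]_q), box x xh z -> box w wh eta ->
      mxle (usubmx (F x xh w wh)) (g z eta) /\
      mxle (g z eta) (dsubmx (F x xh w wh)).

(* In [X_lo] and [X_up], X = C, d, J, H: the lower and upper bounds. *)
Section ActInclusion.
Context {R : realType} {n p q : nat}.
Variable f : 'cV[R]_n -> 'cV[R]_p -> 'cV[R]_q -> 'cV[R]_n.
Variables (C_lo C_up : 'M[R]_(p, n)) (d_lo d_up : 'cV[R]_p).

Definition H_lo (Jx_lo : 'M[R]_(n, n)) (Ju_lo : 'M[R]_(n, p)) : 'M[R]_(n, n) :=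
  Jx_lo + mxpos Ju_lo *m C_lo + mxneg Ju_lo *m C_up.

Definition H_up (Jx_up : 'M[R]_(n, n)) (Ju_up : 'M[R]_(n, p)) : 'M[R]_(n, n) :=
  Jx_up + mxpos Ju_up *m C_up + mxneg Ju_up *m C_lo.

Definition L_act (Jw_lo Jw_up : 'M[R]_(n, q)) : 'M[R]_(n + n, q + q) :=
  block_mx (- mxneg Jw_lo) (mxneg Jw_lo)
           (- mxpos Jw_up) (mxpos Jw_up).

Definition Q_act (Ju_lo Ju_up : 'M[R]_(n, p)) (x : 'cV[R]_n) (u : 'cV[R]_p)
    (w : 'cV[R]_q) : 'cV[R]_(n + n) :=
  col_mx
    (- (Ju_lo *m u) + mxpos Ju_lo *m d_lo + mxneg Ju_lo *m d_up + f x u w)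
    (- (Ju_up *m u) + mxpos Ju_up *m d_up + mxneg Ju_up *m d_lo + f x u w).

Definition F_act
    (u : 'cV[R]_n -> 'cV[R]_n -> 'cV[R]_q -> 'cV[R]_q -> 'cV[R]_p)
    (Jx_lo Jx_up : 'cV[R]_n -> 'cV[R]_n -> 'cV[R]_q -> 'cV[R]_q -> 'M[R]_(n, n))
    (Ju_lo Ju_up : 'cV[R]_n -> 'cV[R]_n -> 'cV[R]_q -> 'cV[R]_q -> 'M[R]_(n, p))
    (Jw_lo Jw_up : 'cV[R]_n -> 'cV[R]_n -> 'cV[R]_q -> 'cV[R]_q -> 'M[R]_(n, q))
    (x xh : 'cV[R]_n) (w wh : 'cV[R]_q) : 'cV[R]_(n + n) :=
  let Hl := H_lo (Jx_lo x xh w wh) (Ju_lo x xh w wh) in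
  let Hu := H_up (Jx_up x xh w wh) (Ju_up x xh w wh) in
  block_mx (mxpos Hl - Jx_lo x xh w wh) (mxneg Hl)
           (mxneg Hu - Jx_up x xh w wh) (mxpos Hu) *m col_mx x xh
  + L_act (Jw_lo x xh w wh) (Jw_up x xh w wh) *m col_mx w wh
  + Q_act (Ju_lo x xh w wh) (Ju_up x xh w wh) x (u x xh w wh) w.
End ActInclusion.

(* Main.v *)
Require Import Defs.
From mathcomp Require Import all_boot all_order all_algebra.
From mathcomp Require Import lra.
From mathcomp Require Import all_classical all_reals all_analysis.
Import Order.TTheory GRing.Theory Num.Theory.
Import numFieldNormedType.Exports.
Local Open Scope classical_set_scope.
Local Open Scope ring_scope.

(* Moving from (x, u, w) to (z, N z, eta) one argument at a time never decreases
   a coordinate, so the mean value theorem bounds each of the three increments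
   of f by the corresponding interval Jacobian. The affine bounds on N turn the
   middle increment into an affine function of z; the total coefficient H of z
   is split as [H]^+ + [H]^- only afterwards, and z is then replaced by the
   endpoints x and xh. *)

Set Implicit Arguments.
Unset Strict Implicit.
Unset Printing Implicit Defensive.

Section IntervalMatrix.
Context {R : realType} {m n : nat}.
Implicit Types (A B : 'M[R]_(m, n)) (v w x xh : 'cV[R]_n).

Lemma mxpos_ge0 A : mxle 0 (mxpos A).
Proof. by move=> i j; rewrite !mxE le_max lexx orbT. Qed.

Lemma mxneg_le0 A : mxle (mxneg A) 0.
Proof. by move=> i j; rewrite !mxE ge_min lexx orbT. Qed.

Lemma mxpos_neg A : mxpos A + mxneg A = A.
Proof. by apply/matrixP => i j; rewrite !mxE addr_max_min addr0. Qed.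

Lemma mxle_mulmxl A v w : mxle 0 A -> mxle v w -> mxle (A *m v) (A *m w).
Proof.
move=> A0 vw i j; rewrite !mxE ler_sum// => k _.
by rewrite ler_wpM2l//; have := A0 i k; rewrite mxE.
Qed.

Lemma mxle_nmulmxl A v w : mxle A 0 -> mxle v w -> mxle (A *m w) (A *m v).
Proof.
move=> A0 vw i j; rewrite !mxE ler_sum// => k _.
by rewrite ler_wnM2l//; have := A0 i k; rewrite mxE.
Qed.

Lemma mxle_mulmxr A B v : mxle A B -> mxle 0 v -> mxle (A *m v) (B *m v).
Proof.
move=> AB v0 i j; rewrite !mxE ler_sum// => k _.
by rewrite ler_wpM2r//; have := v0 k j; rewrite mxE.
Qed.

Lemma mxleD v w x xh : mxle v w -> mxle x xh -> mxle (v + x) (w + xh).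
Proof. by move=> vw xxh i j; rewrite !mxE lerD. Qed.

End IntervalMatrix.

(** The nonnegative part of [A] acts monotonically on vectors and the nonpositive part
    antitonically, so each part meets the opposite endpoint of the interval. *)
Lemma mulmx_ge_pos_neg (R : realType) (m n : nat) (A : 'M[R]_(m, n))
    (v x xh : 'cV[R]_n) :
  mxle x v -> mxle v xh -> mxle (mxpos A *m x + mxneg A *m xh) (A *m v).
Proof.
move=> xv vxh; rewrite -[in X in mxle _ X](mxpos_neg A) mulmxDl.
apply: mxleD; first exact: mxle_mulmxl (mxpos_ge0 A) xv.
exact: mxle_nmulmxl (mxneg_le0 A) vxh.
Qed.

Lemma mulmx_le_pos_neg (R : realType) (m n : nat) (A : 'M[R]_(m, n))
    (v x xh : 'cV[R]_n) :
  mxle x v -> mxle v xh -> mxle (A *m v) (mxpos A *m xh + mxneg A *m x).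
Proof.
move=> xv vxh; rewrite -[in X in mxle X _](mxpos_neg A) mulmxDl.
apply: mxleD; first exact: mxle_mulmxl (mxpos_ge0 A) vxh.
exact: mxle_nmulmxl (mxneg_le0 A) xv.
Qed.

(** Matrix neighbourhoods are generated by entrywise families of neighbourhoods, and transposing
    such a family gives another one. *)
Lemma trmx_continuous (R : realType) (m n : nat) :
  continuous (@trmx R m n).
Proof.
move=> M S [P MP PS]; exists (fun i j => P j i) => [i j|K KP].
  by have := MP j i; rewrite mxE.
by apply: PS => i j; rewrite mxE; exact: KP.
Qed.

(** Transposition is linear and continuous, hence its own differential; the chain rule then removes
    the two transpositions hidden in [cjacobian]. *)
Lemma cjacobianE (R : realType) (m n : nat) (g : 'cV[R]_n -> 'cV[R]_m)
    (x v : 'cV[R]_n) :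
  differentiable g x -> cjacobian g x *m v = 'd g x v.
Proof.
move=> dg.
pose tr k l : 'M[R]_(k, l) -> 'M[R]_(l, k) := trmx.
have ctr k l : continuous (tr k l) by exact: trmx_continuous.
have dtr k l M : differentiable (tr k l) M by exact/linear_differentiable/ctr.
have dgtr : differentiable (g \o tr 1 n) x^T.
  by apply: differentiable_comp; rewrite /tr ?trmxK.
have -> : cjacobian g x = (jacobian (tr m 1 \o (g \o tr 1 n)) x^T)^T by [].
apply: trmx_inj; rewrite trmx_mul trmxK mul_rV_lin1 diff_comp//=.
have dtrE k l M : 'd (tr k l) M = tr k l :> (_ -> _) by exact/diff_lin/ctr.
by rewrite diff_comp/= ?dtrE /tr ?trmxK.
Qed.

(* The mean value theorem is applied to each coordinate separately, so the
   intermediate point depends on the row; only the interval bound on the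
   Jacobian is common to all rows. *)
Lemma interval_mean_value (R : realType) (m n : nat)
    (g : 'cV[R]_n -> 'cV[R]_m) (a b ah : 'cV[R]_n) (Jl Ju : 'M[R]_(m, n)) :
  (forall t, differentiable g t) -> mxle a b -> mxle b ah ->
  (forall t, box a ah t -> box Jl Ju (cjacobian g t)) ->
  mxle (Jl *m (b - a)) (g b - g a) /\ mxle (g b - g a) (Ju *m (b - a)).
Proof.
move=> dg ab bah hJ; set v := b - a.
have v0 : mxle 0 v by move=> i j; rewrite !mxE subr_ge0.
suff key i : exists2 t, box a ah t & (g b - g a) i 0 = (cjacobian g t *m v) i 0.
  by split=> i j; rewrite ord1; have [t /hJ[lo up] ->] := key i;
    apply: mxle_mulmxr.
(* [l] runs along the segment from [a] at 0 to [b] at 1, and [h] is coordinate [i] of [g] along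
   it. *)
pose l (t : R) : 'cV[R]_n := t *: v + a.
pose h (t : R) : R := g (l t) i 0.
have dl (t : R) : is_diff t l (fun s => s *: v).
  by rewrite -[X in is_diff _ _ X]addr0; exact: is_diffD.
have dh (t : R) : is_derive t (1 : R) h ((cjacobian g (l t) *m v) i 0).
  have dgl : differentiable (g \o l) t by apply: differentiable_comp.
  have Dgl : derivable (g \o l) t (1 : R) by exact: diff_derivable.
  apply: DeriveDef; first by have /derivable_mxP := Dgl; exact.
  (* The derivative of a vector-valued map is taken entrywise, so the derivative of [h] is entry [i]
     of the chain rule. *)
  have := derive_mx Dgl; rewrite deriveE// => /matrixP/(_ i 0).
  rewrite [in RHS]mxE => <-.
  by rewrite diff_comp//= diff_val scale1r cjacobianE.
have ch : continuous h.
  by move=> t; apply/differentiable_continuous/derivable1_diffP; case: (dh t).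
have [c c01] := @MVT_segment R h _ 0 1 ler01 (fun t _ => dh t)
  (continuous_subspaceT ch).
rewrite /h /l scale1r scale0r add0r subrK subr0 mulr1 => ghb.
exists (c *: v + a); last by rewrite -ghb !mxE.
(* As [v >= 0] and [0 <= c <= 1], the point [c *: v + a] lies between [a] and [b], and [b] is below
   [ah]. *)
move: c01; rewrite in_itv/= => /andP[c0 c1]; split=> j k; rewrite !mxE.
  by rewrite lerDr mulr_ge0// subr_ge0.
apply: le_trans (bah j k); rewrite -lerBrDr.
by rewrite ler_piMl// subr_ge0.
Qed.

(** Each partial map is [uncurry3 f] composed with a differentiable map into the product, two
    components of which are constant. *)
Lemma differentiable_uncurry3 (R : realType) (n p q : nat)
    (f : 'cV[R]_n -> 'cV[R]_p -> 'cV[R]_q -> 'cV[R]_n) :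
  (forall t, differentiable (uncurry3 f) t) ->
  forall z xi eta,
  [/\ differentiable (fun z' => f z' xi eta) z,
      differentiable (fun xi' => f z xi' eta) xi &
      differentiable (f z xi) eta].
Proof.
move=> df z xi eta.
have cmp (U : normedModType R) (a : U -> 'cV[R]_n) (b : U -> 'cV[R]_p)
    (c : U -> 'cV[R]_q) t :
  differentiable a t -> differentiable b t -> differentiable c t ->
  differentiable (fun s => f (a s) (b s) (c s)) t.
  move=> da db dc.
  exact: (differentiable_comp
    (differentiable_pair (differentiable_pair da db) dc) (df _)).
by split; apply: cmp.
Qed.

Unset Implicit Arguments.

Theorem theorem3 (R : realType) (n p q : nat)
  (f : 'cV[R]_n -> 'cV[R]_p -> 'cV[R]_q -> 'cV[R]_n)
  (hf : continuously_differentiable (uncurry3 f))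
  (N : ffnn R n p)
  (y yh : 'cV[R]_n) (hy : mxle y yh)
  (C_lo C_up : 'M[R]_(p, n)) (d_lo d_up : 'cV[R]_p)
  (hN : forall z : 'cV[R]_n, box y yh z ->
     mxle (C_lo *m z + d_lo) (N z) /\ mxle (N z) (C_up *m z + d_up))
  (u uh : 'cV[R]_n -> 'cV[R]_n -> 'cV[R]_q -> 'cV[R]_q -> 'cV[R]_p)
  (Jx_lo Jx_up : 'cV[R]_n -> 'cV[R]_n -> 'cV[R]_q -> 'cV[R]_q -> 'M[R]_(n, n))
  (Ju_lo Ju_up : 'cV[R]_n -> 'cV[R]_n -> 'cV[R]_q -> 'cV[R]_q -> 'M[R]_(n, p))
  (Jw_lo Jw_up : 'cV[R]_n -> 'cV[R]_n -> 'cV[R]_q -> 'cV[R]_q -> 'M[R]_(n, q))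
  (hu : forall (x xh : 'cV[R]_n) (w wh : 'cV[R]_q),
     mxle x xh -> box x xh `<=` box y yh -> mxle w wh ->
     mxle (u x xh w wh) (uh x xh w wh) /\
     (forall z : 'cV[R]_n, box x xh z ->
        box (u x xh w wh) (uh x xh w wh) (N z)))
  (hJ : forall (x xh : 'cV[R]_n) (w wh : 'cV[R]_q),
     mxle x xh -> box x xh `<=` box y yh -> mxle w wh ->
     forall (z : 'cV[R]_n) (xi : 'cV[R]_p) (eta : 'cV[R]_q),
       box x xh z -> box (u x xh w wh) (uh x xh w wh) xi -> box w wh eta ->
       [/\ box (Jx_lo x xh w wh) (Jx_up x xh w wh) (Dz f z xi eta),
           box (Ju_lo x xh w wh) (Ju_up x xh w wh) (Dxi f z xi eta) &
           box (Jw_lo x xh w wh) (Jw_up x xh w wh) (Deta f z xi eta)]) :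
  localized_inclusion y yh
    (F_act f C_lo C_up d_lo d_up u Jx_lo Jx_up Ju_lo Ju_up Jw_lo Jw_up)
    (closed_loop f N).
Proof.
case: hf => df _ x xh w wh xxh sub wwh z eta [xz zxh] [weta etawh].
have [] := hu x xh w wh xxh sub wwh; have := hJ x xh w wh xxh sub wwh.
rewrite /F_act; cbv zeta; clear hu hJ.
(* With [x], [xh], [w], [wh] fixed, the bounds become plain vectors and matrices. *)
move: (u x xh w wh) (uh x xh w wh) => {}u {}uh.
move: (Jx_lo x xh w wh) (Jx_up x xh w wh) => {}Jx_lo {}Jx_up.
move: (Ju_lo x xh w wh) (Ju_up x xh w wh) => {}Ju_lo {}Ju_up.
move: (Jw_lo x xh w wh) (Jw_up x xh w wh) => {}Jw_lo {}Jw_up {}hJ uuh hu.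
have [uxi xiuh] : box u uh (N z) by exact: hu.
have [Nlo Nup] : mxle (C_lo *m z + d_lo) (N z) /\ mxle (N z) (C_up *m z + d_up).
  by apply/hN/sub.
rewrite /closed_loop; move: (nn_eval N z) uxi xiuh Nlo Nup => xi uxi xiuh Nlo Nup.
(* The corners [u] and [w] lie in their own boxes, so the Jacobian bounds hold while these arguments
   have not yet moved. *)
have box_u : box u uh u by split => // i j.
have box_w : box w wh w by split => // i j.
have dfp := differentiable_uncurry3 df.
have [fz_lo fz_up] : mxle (Jx_lo *m (z - x)) (f z u w - f x u w) /\
    mxle (f z u w - f x u w) (Jx_up *m (z - x)).
  apply: (interval_mean_value (g := fun z => f z u w) _ xz zxh) => t.
    by have [] := dfp t u w.
  by move=> xt; have [] := hJ t u w xt box_u box_w.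
have [fu_lo fu_up] : mxle (Ju_lo *m (xi - u)) (f z xi w - f z u w) /\
    mxle (f z xi w - f z u w) (Ju_up *m (xi - u)).
  apply: (interval_mean_value (g := fun t => f z t w) _ uxi xiuh) => t.
    by have [] := dfp z t w.
  by move=> ut; have [] := hJ z t w (conj xz zxh) ut box_w.
have [fw_lo fw_up] :
    mxle (Jw_lo *m (eta - w)) (f z xi eta - f z xi w) /\
    mxle (f z xi eta - f z xi w) (Jw_up *m (eta - w)).
  apply: (interval_mean_value (g := f z xi) _ weta etawh) => t.
    by have [] := dfp z xi t.
  by move=> wt; have [] := hJ z xi t (conj xz zxh) (conj uxi xiuh) wt.
(* The sign splitting is applied to [eta - w], whose lower endpoint is 0. Only one signed part of
   each [Jw] bound survives, which gives the shape of [L_act]. *)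
have eta_w : mxle 0 (eta - w) by move=> i j; rewrite !mxE subr_ge0.
have eta_wh : mxle (eta - w) (wh - w) by move=> i j; rewrite !mxE lerD2r.
rewrite /L_act /Q_act !mul_block_col !add_col_mx.
rewrite col_mxKu col_mxKd.
have addE (A B : 'cV[R]_n) i j : (A + B) i j = A i j + B i j by rewrite mxE.
have zeroE i j : (0 : 'cV[R]_n) i j = 0 by rewrite mxE.
have oppE (A : 'cV[R]_n) i j : (- A) i j = - A i j by rewrite mxE.
(* Expanding with [E] leaves inequalities that are linear in the entries of matrix products. *)
pose E := (mulmxBl, mulmxDl, mulmxBr, mulmxDr, mulNmx, mulmx0, mulmxA,
   zeroE, addE, oppE).
split=> i j.
- have := mulmx_ge_pos_neg (H_lo C_lo C_up Jx_lo Ju_lo) xz zxh i j.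
  have := mulmx_ge_pos_neg Jw_lo eta_w eta_wh i j.
  have := mulmx_ge_pos_neg Ju_lo Nlo Nup i j.
  have := fz_lo i j; have := fu_lo i j; have := fw_lo i j.
  (* [H_lo] is unfolded only where it multiplies [z], to match the terms in [z] from the mean value
     and affine bounds; inside [mxpos] and [mxneg] it stays opaque. *)
  rewrite [in H_lo _ _ _ _ *m z]/H_lo !E.
  lra.
- have := mulmx_le_pos_neg (H_up C_lo C_up Jx_up Ju_up) xz zxh i j.
  have := mulmx_le_pos_neg Jw_up eta_w eta_wh i j.
  have := mulmx_le_pos_neg Ju_up Nlo Nup i j.
  have := fz_up i j; have := fu_up i j; have := fw_up i j.
  rewrite [in H_up _ _ _ _ *m z]/H_up !E.
  lra.
Qed.
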